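(* Let $k\ge3$. The space $(M(1)^++C_2(V_L^+))/C_2(V_L^+)$ is spanned by the classes of $L(-2)^sJ_{-1}^t\mathbf 1$, $s,t\in\mathbb{Z}_{\ge0}$.
   Context: $L=\mathbb{Z}\alpha$, $\langle\alpha,\alpha\rangle=2k$; $V_L=M(1)\otimes\mathbb{C}[L]$ the lattice VOA with conformal vector $\omega=\frac1{4k}\alpha(-1)^2\mathbf1$, $L(n)=\omega_{n+1}$; $V_L^+$ the fixed points of the involution $\theta$ lifted from $-1$ on $L$; $M(1)^+$ the $\theta$-fixed part of $M(1)$. $J=\frac{1}{4k^2}\alpha(-1)^4\mathbf1-\frac1k\alpha(-3)\alpha(-1)\mathbf1+\frac{3}{4k}\alpha(-2)^2\mathbf1$, $J_{-1}$ is the $(-1)$-mode of $Y(J,z)=\sum J_nz^{-n-1}$, and $L(-2)^s$, $J_{-1}^t$ denote operator powers. $C_2(V)$ is the span of $\{v_{-2}u:u,v\in V\}$. *)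

(* Defs.v *)
From mathcomp Require Import all_boot all_algebra.
From mathcomp Require Import finmap multiset.
From mathcomp.multinomials Require Import monalg.

Set Implicit Arguments.
Unset Strict Implicit.
Unset Printing Implicit Defensive.

Import GRing.Theory.
Local Open Scope ring_scope.

(* The lattice VOA V_L, L = Z alpha, <alpha,alpha> = 2k, over a field F.     *)
(* Basis of V_L = M(1) (x) C[L]:  a pair (A, m) with A a finite multiset of  *)
(* natural numbers and m : int, standing for                                *)
(*        prod_{j in A} alpha(-(j+1))  (x)  e^{m alpha}                     *)
(* (an element j of A, with multiplicity, stands for the factor alpha(-j-1)).*)
(* The 2-cocycle on L is taken trivial (possible since L is even, all inner  *)
(* products being even).                                                     *)

Definition VLbasis := (multiset nat * int)%type.
Definition VL (F : fieldType) := {malg F[VLbasis]}.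

Section LatticeVOA.
Context (F : fieldType) (k : nat).

Local Notation V := (VL F).

Definition bvec (b : VLbasis) : V := mkmalgU b 1.

Definition linext (f : VLbasis -> V) (v : V) : V :=
  \sum_(b <- msupp v) v@_b *: f b.

Definition vac : V := bvec (mset0, 0%Z).

(* Heisenberg operators alpha(n), n in Z, on basis vectors:
   alpha(-n) (n>0) multiplies by alpha(-n);
   alpha(0) acts on e^{m alpha} by <alpha, m alpha> = 2 k m;
   alpha(n) (n>0) acts as n <alpha,alpha> d/d alpha(-n). *)
Definition heis_b (n : int) (b : VLbasis) : V :=
  let: (A, m) := b in
  if (n < 0)%R then bvec (((`|n|%N.-1) +` A)%mset, m)
  else if n == 0 then ((2 * k)%:R * m%:~R) *: bvec b
  else ((2 * k * `|n| * A (`|n|%N.-1))%:R) *: bvec ((A `\ (`|n|%N.-1))%mset, m).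

Definition heis (n : int) : V -> V := linext (heis_b n).

(* conformal weight of a basis vector: sum of the n's plus <beta,beta>/2 *)
Definition wtB (b : VLbasis) : nat :=
  (\sum_(j <- enum_mset b.1) j.+1 + k * `|b.2| ^ 2)%N.

(* S^-_e (beta = m alpha): coefficient of z^e in
   E^-(-beta,z) = exp(sum_{n>0} beta(-n)/n z^n);  e S_e = sum_j beta(-j) S_{e-j}.
   (The first nat argument is fuel; it is used with fuel = e.) *)
Fixpoint Sminus (m : int) (fuel e : nat) (w : V) {struct fuel} : V :=
  if e == 0%N then w else
  match fuel with
  | 0%N => 0
  | f.+1 => (e%:R)^-1 *:
      \sum_(1 <= j < e.+1) (m%:~R *: heis (- (j%:Z)) (Sminus m f (e - j) w))
  end.

(* S^+_d: coefficient of z^{-d} in E^+(-beta,z) = exp(-sum_{n>0} beta(n)/n z^{-n});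
   d S_d = sum_j (-beta(j)) S_{d-j}. *)
Fixpoint Splus (m : int) (fuel d : nat) (w : V) {struct fuel} : V :=
  if d == 0%N then w else
  match fuel with
  | 0%N => 0
  | f.+1 => (d%:R)^-1 *:
      \sum_(1 <= j < d.+1) ((- m)%:~R *: heis (j%:Z) (Splus m f (d - j) w))
  end.

(* Modes of Y(e^{m alpha}, z) = E^-(-beta,z) E^+(-beta,z) e_beta z^beta on a
   basis vector q (x) e^{m' alpha}: the coefficient of z^{-p-1}. *)
Definition Emode (m p : int) (c : VLbasis) : V :=
  let: (A, m') := c in
  let N0 := (2 * k)%:Z * m * m' in
  \sum_(d < (wtB c).+1)
    (let e := (d%:Z - p - 1 - N0)%R in
     if (0 <= e)%R then Sminus m `|e| `|e| (Splus m d d (bvec (A, (m + m')%R)))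
     else 0).

(* Modes of Y(alpha(-(j1+1)) ... alpha(-(jr+1)) e^{m alpha}, z), computed by the
   iterate formula (u = alpha(-1)1, u_q = alpha(q), n = j+1 >= 1):
   (alpha(-n) v)_p w = sum_{i>=0} C(n+i-1,i)
                 ( alpha(-n-i) v_{p+i} w - (-1)^n v_{p-n-i} alpha(i) w ),
   the sum being finite (terms with i > wt v + wt w + |p| vanish). *)
Fixpoint modeB (s : seq nat) (m p : int) (c : VLbasis) {struct s} : V :=
  match s with
  | [::] => Emode m p c
  | j :: s' =>
      \sum_(i < (wtB (seq_mset s', m) + wtB c + `|p|).+1)
        ('C(j + i, i)%:R *:
          (heis (- ((j.+1 + i)%N%:Z)) (modeB s' m (p + i%:Z) c)
           - ((-1) ^+ j.+1) *: linext (modeB s' m (p - (j.+1 + i)%N%:Z)) (heis i%:Z (bvec c))))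
  end.

(* v_p w for arbitrary v, w in V_L:  Y(v,z) w = sum_p v_p w z^{-p-1}. *)
Definition Ymode (v : V) (p : int) (w : V) : V :=
  \sum_(b <- msupp v) v@_b *: linext (modeB (enum_mset b.1) b.2 p) w.

(* The involution theta: alpha(-n) -> -alpha(-n), e^beta -> e^{-beta}. *)
Definition theta_b (b : VLbasis) : V :=
  ((-1) ^+ size (enum_mset b.1)) *: bvec (b.1, (- b.2)%R).
Definition theta : V -> V := linext theta_b.

Definition VLplus (v : V) : Prop := theta v = v.
Definition M1plus (v : V) : Prop :=
  (forall b, b \in msupp v -> b.2 = 0%Z) /\ theta v = v.

(* C_2(V_L^+) : span of { v_{-2} u : u, v in V_L^+ } (finite sums; scalars
   are absorbed since V_L^+ is a subspace). *)
Definition C2 (x : V) : Prop :=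
  exists r : seq (V * V),
    (forall ab, ab \in r -> VLplus ab.1 /\ VLplus ab.2) /\
    x = \sum_(ab <- r) Ymode ab.1 (-2) ab.2.

Definition omega : V := ((4 * k)%:R)^-1 *: heis (-1) (heis (-1) vac).
Definition Lop (n : int) : V -> V := Ymode omega (n + 1).

Definition Jvec : V :=
  ((4 * k ^ 2)%:R)^-1 *: heis (-1) (heis (-1) (heis (-1) (heis (-1) vac)))
  - (k%:R)^-1 *: heis (-3) (heis (-1) vac)
  + (3%:R / (4 * k)%:R) *: heis (-2) (heis (-2) vac).

Definition LJ (s t : nat) : V :=
  iter s (Lop (-2)) (iter t (Ymode Jvec (-1)) vac).

End LatticeVOA.

(* Main.v *)
(* M(1)^+ is already spanned by the L(-2)^s 1 and L(-2)^s J modulo the modes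
   b_{-2} c with b quadratic and c in M(1)^+; the charged sectors play no role.

   Modulo such modes and shorter monomials, a unit of weight can be moved from one
   factor of a monomial to another at the cost of a sign. With three or more factors
   two ways of moving conflict, so that every monomial containing some alpha(-n),
   n >= 2, reduces to shorter ones, while alpha(-1)^{2r} is L(-2) applied to
   alpha(-1)^{2r-2} up to shorter terms. There remain the quadratic vectors, which
   are multiples of X_n = alpha(-n-1)alpha(-1)1. They vanish for n odd by symmetry,
   X_0 is a multiple of L(-2)1, X_2 is obtained from J, and for even n >= 2
   the relation L(-2) X_n = (n+3)(n+4)/4 X_{n+2}, whose coefficient is not zero, is
   found by reducing alpha(-1)^3 alpha(-n-1) with its lower order terms.

   L(-2) preserves the span of the modes b_{-2} c, because the modes of quadratic
   vectors of a given weight shift are the sums of f(i) alpha(i) alpha(-M-i) with f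
   a polynomial of bounded degree, and commuting with L(-2) raises M by 2 and the
   degree of f by at most 1. *)

From HB Require Import structures.
Require Import Defs.
From mathcomp Require Import all_boot all_order all_algebra.
From mathcomp Require Import finmap multiset.
From mathcomp.multinomials Require Import monalg.
From mathcomp Require Import ring zify.
Set Implicit Arguments.
Unset Strict Implicit.
Unset Printing Implicit Defensive.
Import Order.TTheory GRing.Theory Num.Theory.
Local Open Scope ring_scope.

(** * Linear spans *)

Section LinearSpan.
Context (F : fieldType) (V : lmodType F).

Inductive lspan (G : V -> Prop) : V -> Prop :=
| lspan0 : lspan G 0
| lspan_cons c g v : G g -> lspan G v -> lspan G (c *: g + v).

Lemma lspan_gen (G : V -> Prop) g : G g -> lspan G g.
Proof.
by move=> Gg; rewrite -[g]addr0 -[g]scale1r; apply: lspan_cons => //; apply: lspan0.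
Qed.

Lemma lspanD (G : V -> Prop) u v : lspan G u -> lspan G v -> lspan G (u + v).
Proof.
move=> Gu Gv; elim: Gu => [|c g w Gg _ IH]; first by rewrite add0r.
by rewrite -addrA; apply: lspan_cons.
Qed.

Lemma lspanZ (G : V -> Prop) c v : lspan G v -> lspan G (c *: v).
Proof.
elim=> [|d g w Gg _ IH]; first by rewrite scaler0; apply: lspan0.
by rewrite scalerDr scalerA; apply: lspan_cons.
Qed.

Lemma lspan_sum (G : V -> Prop) (I : Type) (r : seq I) (P : pred I) (f : I -> V) :
  (forall i, P i -> lspan G (f i)) -> lspan G (\sum_(i <- r | P i) f i).
Proof. by move=> Gf; elim/big_ind: _ => //; [apply: lspan0|apply: lspanD]. Qed.

Lemma lspan_map (G H : V -> Prop) (f : {linear V -> V}) v :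
  (forall g, G g -> lspan H (f g)) -> lspan G v -> lspan H (f v).
Proof.
move=> GH; elim=> [|c g w Gg _ IH]; first by rewrite linear0; apply: lspan0.
by rewrite linearP; apply: lspanD => //; apply/lspanZ/GH.
Qed.

Lemma lspan_sub (G H : V -> Prop) v :
  (forall g, G g -> lspan H g) -> lspan G v -> lspan H v.
Proof. exact: (@lspan_map G H idfun). Qed.

Lemma lspan_eq (G : V -> Prop) (f g : {linear V -> V}) v :
  (forall w, G w -> f w = g w) -> lspan G v -> f v = g v.
Proof.
move=> fg; elim=> [|c w u Gw _ IH]; first by rewrite !linear0.
by rewrite !linearP fg // IH.
Qed.

(** [C] is only assumed closed under combinations, because [C2] is given by lists of pairs and not
    as an [lspan]. *)
Lemma lspan_split (G H C : V -> Prop) v : C 0 ->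
  (forall c u w, C u -> C w -> C (c *: u + w)) ->
  (forall g, G g -> C g \/ H g) ->
  lspan G v -> exists2 u, lspan H u & C (v - u).
Proof.
move=> C0 CP GCH; elim=> [|c g w /GCH[Cg|Hg] _ [u Hu Cu]].
- by exists 0; [apply: lspan0|rewrite subr0].
- by exists u => //; rewrite -addrA; apply: CP.
exists (c *: g + u); first exact: lspan_cons.
by rewrite opprD addrACA subrr add0r.
Qed.

(** Quantifying over all large [n] lets the induction absorb a new index pair by enlarging the
    square of summation. *)
Lemma lspan_double_sum (e : nat -> nat -> V) v :
  lspan (fun g => exists s t, g = e s t) v ->
  exists n0 (c : nat -> nat -> F), forall n, (n0 <= n)%N ->
    v = \sum_(s < n) \sum_(t < n) c s t *: e s t.
Proof.
elim=> [|a g w [s0 [t0 ->]] _ [n0 [c wE]]].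
  exists 0%N, (fun _ _ => 0) => n _.
  by rewrite big1 // => s _; rewrite big1 // => t _; rewrite scale0r.
exists (maxn n0 (maxn s0 t0).+1).
exists (fun s t => a * ((s == s0) && (t == t0))%:R + c s t) => n.
rewrite geq_max => /andP[/wE {1}-> {wE}]; rewrite gtn_max => /andP[hs ht].
have -> : a *: e s0 t0 = \sum_(s < n) \sum_(t < n)
    (a * (((s : nat) == s0) && ((t : nat) == t0))%:R) *: e s t.
  rewrite (bigD1 (Ordinal hs)) //= (bigD1 (Ordinal ht)) //= !eqxx mulr1.
  rewrite big1 ?addr0 => [|t /negPf nt]; last first.
    by rewrite -[_ == t0]/(t == Ordinal ht) nt andbF mulr0 scale0r.
  rewrite big1 ?addr0 // => s /negPf ns; rewrite big1 // => t _.
  by rewrite -[_ == s0]/(s == Ordinal hs) ns mulr0 scale0r.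
rewrite -big_split; apply: eq_bigr => s _ /=; rewrite -big_split.
by apply: eq_bigr => t _; rewrite /= scalerDl.
Qed.

(** Congruence of [x] to [c *: X] turns relations between vectors into scalar arithmetic: two
    different coefficients for one vector force [X] into the span. *)
Definition equals_mod (G : V -> Prop) (X x : V) (c : F) := lspan G (x - c *: X).

Context (G : V -> Prop) (X : V).
Local Notation P := (equals_mod G X).

Lemma equals_mod_refl : P X 1.
Proof. by rewrite /equals_mod scale1r subrr; apply: lspan0. Qed.

Lemma equals_mod0 x : lspan G x -> P x 0.
Proof. by rewrite /equals_mod scale0r subr0. Qed.

Lemma equals_modD x y c d : P x c -> P y d -> P (x + y) (c + d).
Proof. by move=> px py; rewrite /equals_mod scalerDl opprD addrACA; apply: lspanD. Qed.

Lemma equals_modZ a x c : P x c -> P (a *: x) (a * c).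
Proof. by move=> px; rewrite /equals_mod -scalerA -scalerBr; apply: lspanZ. Qed.

Lemma equals_modB x y c d : P x c -> P y d -> P (x - y) (c - d).
Proof.
move=> px py; apply: equals_modD => //.
by rewrite -[- y]scaleN1r -[- d]mulN1r; apply: equals_modZ.
Qed.

Lemma equals_mod_cancel a x c : a != 0 -> P (a *: x) (a * c) -> P x c.
Proof.
move=> a0 /(equals_modZ a^-1).
by rewrite scalerA mulrA mulVf // scale1r mul1r.
Qed.

Lemma equals_mod_generator c : c != 0 -> P 0 c -> lspan G X.
Proof.
move=> c0; rewrite /equals_mod sub0r -scaleNr => /(lspanZ (- c)^-1).
by rewrite scalerA mulVf ?oppr_eq0 // scale1r.
Qed.

End LinearSpan.

(** * Quadratic operators on a bosonic Fock space *)

(* [word [:: a1; ...; ar]] stands for alpha(-a1-1)...alpha(-ar-1)1, [cr a] for the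
   operator alpha(-a-1), [kap] for <alpha,alpha>, and [der phi M] for the derivation
   sending the factor alpha(-a-1) to phi(a) alpha(-a-M-1). *)
Section BosonicFock.
Context (F : fieldType) (charF : [pchar F] =i pred0) (V : lmodType F).
Context (kap : F) (word : seq nat -> V).
Context (cr : nat -> {linear V -> V}) (der : (nat -> F) -> nat -> {linear V -> V}).
Context (word_perm : forall s t, perm_eq s t -> word s = word t).
Context (cr_word : forall a s, cr a (word s) = word (a :: s)).
Context (cr_comm : forall a b v, cr a (cr b v) = cr b (cr a v)).
Context (der_nil : forall phi M, der phi M (word [::]) = 0).
Context (der_cr : forall phi M a v,
  der phi M (cr a v) = cr a (der phi M v) + phi a *: cr (a + M) v).

Lemma natr_neq0 n : n.+1%:R != 0 :> F.
Proof. by rewrite ((pcharf0P F).1 charF). Qed.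

Lemma word_swap a b s : word (a :: b :: s) = word (b :: a :: s).
Proof. by rewrite -!cr_word cr_comm. Qed.

Lemma der_cons phi M a s :
  der phi M (word (a :: s)) = cr a (der phi M (word s)) + phi a *: word ((a + M)%N :: s).
Proof. by rewrite -cr_word der_cr cr_word. Qed.

Lemma der_pair phi M a b :
  der phi M (word [:: a; b]) =
  phi b *: word [:: a; (b + M)%N] + phi a *: word [:: (a + M)%N; b].
Proof. by rewrite !der_cons der_nil linear0 add0r linearZ /= cr_word. Qed.

Lemma der_span phi M s :
  lspan (fun v => exists2 t, size t = size s & v = word t) (der phi M (word s)).
Proof.
elim: s => [|a s IH]; first by rewrite der_nil; apply: lspan0.
rewrite der_cons; apply: lspanD.
  apply: lspan_map IH => _ [t st ->]; rewrite cr_word; apply: lspan_gen.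
  by exists (a :: t) => //=; rewrite st.
by apply/lspanZ/lspan_gen; exists ((a + M)%N :: s).
Qed.

(* [quad j1 j2 q] is the mode (alpha(-j1-1)alpha(-j2-1)1)_{-q-1}. Its terms with one
   annihilation operator form a derivation, and none has two. *)
Definition quad_coef (j1 j2 q a : nat) : F := a.+1%:R *
  ((-1) ^+ j2 * 'C(a + q + j1 + j2 + 2, j1)%:R * 'C(a + 1 + j2, j2)%:R
   + (-1) ^+ j1 * 'C(j1 + a + 1, j1)%:R * 'C(a + q + j1 + j2 + 2, j2)%:R).

Definition quad j1 j2 q v : V :=
  \sum_(i < q.+1) ('C(j1 + i, i)%:R * 'C(j2 + (q - i), q - i)%:R) *:
     cr (j1 + i) (cr (j2 + (q - i)) v)
  + kap *: der (quad_coef j1 j2 q) (j1 + j2 + q + 2) v.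

Lemma quad0_word s : quad 0 0 0 (word s) =
  word (0 :: 0 :: s)%N + kap *: der (quad_coef 0 0 0) 2 (word s).
Proof. by rewrite /quad big_ord1 bin0 mulr1 scale1r !cr_word. Qed.

Lemma quad1_word a b s : quad a b 1 (word s) =
  b.+1%:R *: word (a :: b.+1 :: s) + a.+1%:R *: word (a.+1 :: b :: s)
  + kap *: der (quad_coef a b 1) (a + b + 3) (word s).
Proof.
rewrite /quad big_ord_recl big_ord1 /= !cr_word !bin0 !bin1 mul1r mulr1.
by rewrite addn0 !addn1 addn0 addSnnS.
Qed.

Lemma quad_coef0 x : quad_coef 0 0 0 x = 2 * x.+1%:R.
Proof. by rewrite /quad_coef !bin0; ring. Qed.

Lemma quad_coef01 x : quad_coef 0 0 1 x = 2 * x.+1%:R.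
Proof. by rewrite /quad_coef !bin0; ring. Qed.

(** Needed later because the enumeration of a two-letter multiset may list its letters in either
    order. *)
Lemma quad_swap j1 j2 q s : quad j1 j2 q (word s) = quad j2 j1 q (word s).
Proof.
rewrite /quad; congr (_ + _ *: _).
  rewrite (reindex_inj rev_ord_inj) /=; apply: eq_bigr => i _.
  by rewrite subSS subKn ?leq_ord // mulrC cr_comm.
rewrite (addnC j1 j2); elim: s => [|a s IH]; first by rewrite !der_nil.
rewrite !der_cons IH; congr (_ + _ *: _); rewrite /quad_coef.
have -> : (a + q + j2 + j1 + 2 = a + q + j1 + j2 + 2)%N by lia.
have -> : (a + 1 + j1 = j1 + a + 1)%N by lia.
have -> : (a + 1 + j2 = j2 + a + 1)%N by lia.
by ring.
Qed.

Context (kap_neq0 : kap != 0).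

(** * Reduction of words of even length *)

Section Reduction.
Context (G : V -> Prop) (L : {linear V -> V}).
Local Notation W := (lspan G).
Context (L_word : forall s, L (word s) = (2 * kap)^-1 *: quad 0 0 0 (word s)).
Context (G_L : forall v, W v -> W (L v)).
Context (G_vac : W (word [::])).
Context (G_quad : forall a b s, ~~ odd (size s) -> W (quad a b 1 (word s))).
Context (G_J : W (kap ^- 2 *: word [:: 0; 0; 0; 0]%N - (2 / kap) *: word [:: 2; 0]%N
  + (3 / (2 * kap)) *: word [:: 1; 1]%N)).

Local Notation X n := (word [:: n; 0]%N).

Lemma move_pair a b :
  W (b.+1%:R *: word [:: a; b.+1] + a.+1%:R *: word [:: a.+1; b]).
Proof. by have := @G_quad a b [::] isT; rewrite quad1_word der_nil scaler0 addr0. Qed.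

(** Each use of [move_pair] contributes the ratio -(a+1)/(b+1), and these ratios accumulate to a
    signed binomial coefficient. *)
Lemma pair_equals a b :
  equals_mod G (X (a + b)) (word [:: a; b]) ((-1) ^+ b * 'C(a + b, b)%:R).
Proof.
elim: b a => [|b IH] a.
  by rewrite addn0 bin0 mulr1; apply: equals_mod_refl.
apply: (equals_mod_cancel (natr_neq0 b)).
have := equals_modB (equals_mod0 (X (a + b.+1)) (move_pair a b))
  (equals_modZ a.+1%:R _).
move/(_ (word [:: a.+1; b]) ((-1) ^+ b * 'C(a + b.+1, b)%:R)).
rewrite addnS -addSn addrK => /(_ (IH a.+1)).
congr (equals_mod _ _ _ _).
have /(congr1 (fun n => n%:R : F)) := mul_bin_left (a.+1 + b) b.
rewrite addnK !natrM exprS => e.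
transitivity (- (-1) ^+ b * (b.+1%:R * 'C(a.+1 + b, b.+1)%:R) : F); last by ring.
by rewrite e; ring.
Qed.

(** Moving all the weight across exchanges the two letters, so X_n is congruent to -X_n. *)
Lemma pair0_odd n : odd n -> W (X n).
Proof.
move=> on; have := pair_equals 0 n; rewrite add0n binn mulr1 -signr_odd on expr1.
rewrite (word_swap 0 n) => h.
have := equals_modB (equals_mod_refl G (X n)) h; rewrite subrr opprK.
by apply: equals_mod_generator; rewrite -(natrD _ 1 1) natr_neq0.
Qed.

(* The two relations give alpha(-1)^3 alpha(-n-2) as a multiple of [X n.+3]: first
   a unit is moved from alpha(-n-2) to one factor alpha(-1), then on to another. *)
Lemma pair0_step n : odd n -> W (X n.+1) -> W (X n.+3).
Proof.
move=> on WX; set Y := X n.+3; set P := equals_mod G Y.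
set C3 := 'C(n.+3, 3)%:R : F.
have PY : P Y 1 by apply: equals_mod_refl.
have odd_sign : (-1) ^+ n = -1 :> F by rewrite -signr_odd on expr1.
have P_n3 : P (word [:: n; 3]%N) (- C3).
  have -> : - C3 = (-1) ^+ 3 * C3 by ring.
  by have := pair_equals n 3; rewrite addn3.
have P_swap : P (word [:: 2; n.+1]%N) ('C(n.+3, 2)%:R).
  have := pair_equals n.+1 2; rewrite addn2 (word_swap n.+1 2).
  by rewrite sqrrN expr1n mul1r.
(* The mode (alpha(-1)^2 1)_{-2} acts on alpha(-n-1)alpha(-1)1; its two longest terms coincide,
   whence the factor 2. *)
have P1 : P (word [:: 0; 1; n; 0]%N) (kap * (C3 - n.+1%:R)).
  have /(equals_mod0 Y) := @G_quad 0 0 [:: n; 0]%N isT; rewrite quad1_word.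
  rewrite [word [:: 1, _ & _]%N]word_swap -scalerDl der_pair !quad_coef01.
  rewrite !add0n (addn3 n) -/Y => h.
  have h' : P (kap *: ((2 * 1%:R) *: word [:: n; 3]%N + (2 * n.+1%:R) *: Y))
    (kap * (2 * 1%:R * - C3 + 2 * n.+1%:R * 1)).
    by apply/equals_modZ/equals_modD; apply: equals_modZ.
  have := equals_modB h h'; rewrite addrK.
  have -> : (1%:R + 1%:R) = 2 :> F by ring.
  have -> : 0 - kap * (2 * 1%:R * - C3 + 2 * n.+1%:R * 1) = 2 * (kap * (C3 - n.+1%:R)) :> F.
    by ring.
  by apply: equals_mod_cancel; apply: (natr_neq0 1).
(* The mode (alpha(-1)alpha(-n-1)1)_{-2} acts on alpha(-1)^2 1; one of its longest terms is the word
   of [P1]. *)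
have P0 : P (n.+1%:R *: word [:: 0; n.+1; 0; 0]%N) (- 3 * kap * (C3 - n.+1%:R)).
  have /(equals_mod0 Y) := @G_quad 0 n [:: 0; 0]%N isT; rewrite quad1_word.
  have -> : word [:: 1; n; 0; 0]%N = word [:: 0; 1; n; 0]%N.
    by rewrite -!cr_word [in RHS]cr_comm [cr 0 (cr n _)]cr_comm.
  have c0 : quad_coef 0 n 1 0 = C3 - n.+1%:R.
    have e1 : (0 + 1 + 0 + n + 2 = n.+3)%N by lia.
    have e3 : 'C(n.+3, n) = 'C(n.+3, 3) by rewrite -(@bin_sub n.+3 3) // !subSS subn0.
    by rewrite /quad_coef !bin0 odd_sign e1 e3 -/C3 add0n add1n binSn; ring.
  rewrite der_pair c0 !add0n addn3 (word_swap 0 n.+3) -/Y -scalerDl -addrA => h.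
  have h' : P (1%:R *: word [:: 0; 1; n; 0]%N
      + kap *: ((C3 - n.+1%:R + (C3 - n.+1%:R)) *: Y))
    (1%:R * (kap * (C3 - n.+1%:R)) + kap * ((C3 - n.+1%:R + (C3 - n.+1%:R)) * 1)).
    by apply: equals_modD; do !apply: equals_modZ.
  by have := equals_modB h h'; rewrite addrK; congr (P _ _); ring.
have {}P0 : P (word [:: 0; 0; n.+1; 0]%N) (- 3 * kap * (C3 - n.+1%:R) / n.+1%:R).
  rewrite -cr_word word_swap cr_word; apply: (equals_mod_cancel (natr_neq0 n)).
  by rewrite mulrC divfK ?natr_neq0.
(* L(-2)X_{n+1} lies in the span; [P0] and [P_swap] turn its expansion into a multiple of [Y]. *)
have := equals_modB (equals_mod0 Y (G_L WX))
  (equals_modZ (2 * kap)^-1 (equals_modD P0 (equals_modZ kap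
    (equals_modD (equals_modZ 2 P_swap) (equals_modZ (2 * n.+2%:R) PY))))).
rewrite L_word quad0_word der_pair !quad_coef0 !addn2 (word_swap n.+1 2) mulr1 subrr.
apply: equals_mod_generator.
(* The binomials are written as polynomials in n so that [field] can evaluate the coefficient, from
   which [kap] cancels. *)
have e3 : 3 * C3 = n.+3%:R * 'C(n.+2, 2)%:R by rewrite -!natrM -mul_bin_diag.
have e2 : 2 * 'C(n.+2, 2)%:R = n.+2%:R * n.+1%:R :> F.
  by rewrite -!natrM -mul_bin_diag bin1.
have e2' : 2 * 'C(n.+3, 2)%:R = n.+3%:R * n.+2%:R :> F.
  by rewrite -!natrM -mul_bin_diag bin1.
have -> : C3 = n.+3%:R * n.+2%:R * n.+1%:R / 6.
  have -> : C3 = n.+3%:R * (2 * 'C(n.+2, 2)%:R) / 6.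
    have -> : C3 = (3 * C3) / 3 by field; rewrite natr_neq0.
    by rewrite e3; field; rewrite !natr_neq0.
  by rewrite e2 mulrA.
have -> : 'C(n.+3, 2)%:R = n.+3%:R * n.+2%:R / 2 :> F.
  by rewrite -e2'; field; rewrite natr_neq0.
set c := (X in X != 0).
have -> : c = - (n.+4%:R * n.+4.+1%:R / 4).
  by rewrite /c; field; rewrite nat1r !natr_neq0 kap_neq0.
by rewrite oppr_eq0 !mulf_neq0 ?invr_eq0 ?natr_neq0.
Qed.

Lemma two_kap_neq0 : 2 * kap != 0.
Proof. by rewrite mulf_neq0 ?(natr_neq0 1). Qed.

Lemma in_of_scale c v : c != 0 -> W (c *: v) -> W v.
Proof. by move=> c0 /(lspanZ c^-1); rewrite scalerA mulVf // scale1r. Qed.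

Lemma quad0_in s : W (word s) -> W (quad 0 0 0 (word s)).
Proof.
move/G_L; rewrite L_word; apply: in_of_scale.
by rewrite invr_eq0 two_kap_neq0.
Qed.

Lemma in_of_addl u v : W (u + v) -> W v -> W u.
Proof. by move=> h /(lspanZ (-1)) /(lspanD h); rewrite scaleN1r addrK. Qed.

Lemma pair0_0 : W (X 0).
Proof. by have := quad0_in G_vac; rewrite quad0_word der_nil scaler0 addr0. Qed.

Lemma pair0_2 : W (X 2).
Proof.
(* L(-2)X_0 expresses alpha(-1)^4 1 through X_2. *)
have P4 : equals_mod G (X 2) (word [:: 0; 0; 0; 0]%N) (- (4 * kap)).
  have := equals_mod0 (X 2) (quad0_in pair0_0).
  rewrite quad0_word der_pair quad_coef0 add0n (word_swap 0 2) -scalerDl scalerA => h.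
  have := equals_modB h (equals_modZ (4 * kap) (equals_mod_refl G (X 2))).
  have -> : 4 * kap = kap * (2 * 1 + 2 * 1) :> F by ring.
  by rewrite addrK; congr (equals_mod _ _ _ _); ring.
have := equals_modB (equals_mod0 (X 2) G_J) (equals_modD
  (equals_modB (equals_modZ (kap ^- 2) P4)
    (equals_modZ (2 / kap) (equals_mod_refl G (X 2))))
  (equals_modZ (3 / (2 * kap)) (pair_equals 1 1))).
rewrite subrr; apply: equals_mod_generator.
rewrite binSn expr1; set c := (X in X != 0).
(* Thus J is congruent to -(9/kap) X_2. *)
have -> : c = 9 / kap by rewrite /c; field; rewrite natr_neq0 kap_neq0.
by rewrite mulf_neq0 ?invr_eq0 ?natr_neq0.
Qed.

Lemma pair0_in n : W (X n).
Proof.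
elim/ltn_ind: n => -[|[|[|n]]] IH.
- exact: pair0_0.
- exact: pair0_odd.
- exact: pair0_2.
case: (boolP (odd n)) => on; first exact: pair0_step on (IH _ _).
by apply: pair0_odd; rewrite /= negbK.
Qed.

Lemma pair_in a b : W (word [:: a; b]).
Proof.
have := pair_equals a b; rewrite /equals_mod -scaleNr => /in_of_addl; apply.
exact/lspanZ/pair0_in.
Qed.

Section LongerWords.
Context (m : nat) (m_even : ~~ odd m) (IH : forall s, size s = m -> W (word s)).

(** Derivations keep the length, so the annihilation part of a mode on a word of length m is already
    covered by [IH]. *)
Lemma der_in phi M s : size s = m -> W (der phi M (word s)).
Proof.
move=> sz; apply: lspan_sub (der_span phi M s) => _ [t st ->]; apply: IH.
by rewrite st.
Qed.

Lemma move_in a b s : size s = m ->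
  W (word (a :: b.+1 :: s)) -> W (word (a.+1 :: b :: s)).
Proof.
move=> sz h; have := @G_quad a b s; rewrite sz => /(_ m_even).
rewrite quad1_word => /in_of_addl /(_ (lspanZ _ (der_in _ _ sz))).
rewrite addrC => /in_of_addl /(_ (lspanZ _ h)).
exact: in_of_scale (natr_neq0 a).
Qed.

Lemma collect_in a b s : size s = m ->
  W (word ((a + b)%N :: 0%N :: s)) -> W (word (a :: b :: s)).
Proof.
move=> sz; elim: a b => [|a IHa] b h; first by rewrite word_swap.
by apply: move_in sz _; apply: IHa; rewrite addnS -addSn.
Qed.

(* Moving the unit of weight from the first factor to the second changes the sign. *)
Lemma one_zero_in s : size s = m -> W (word (1 :: 0 :: s)%N).
Proof.
move=> sz; have := @G_quad 0 0 s; rewrite sz => /(_ m_even).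
rewrite quad1_word => /in_of_addl /(_ (lspanZ _ (der_in _ _ sz))).
by rewrite (word_swap 0 1) -scalerDl; apply: in_of_scale (natr_neq0 1).
Qed.

(** A third letter is available: it is emptied into the first, leaving two letters alpha(-1). A unit
    moved to one of them forms with the other a pair killed by [one_zero_in]. *)
Lemma top_in n s : size s = m -> (0 < m)%N -> W (word (n.+1 :: 0 :: s)%N).
Proof.
case: s => [|b s] sz m0; first by rewrite -sz in m0.
have cons_swap a c d t : word (a :: c :: d :: t) = word (a :: d :: c :: t).
  by rewrite -(cr_word a) word_swap cr_word.
rewrite cons_swap; apply: collect_in => //.
rewrite addSn; apply: (@move_in (n + b) 0 (0%N :: s) sz).
by rewrite word_swap cons_swap; apply: one_zero_in.
Qed.

Lemma longer_in s : (0 < m)%N -> size s = m.+2 -> W (word s).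
Proof.
(* The word alpha(-1)^{m+2} is the leading term of L(-2) on alpha(-1)^m, up to a scalar. *)
move=> m0 sz; case: (boolP (all (pred1 0%N) s)) => [/all_pred1P s0|].
  move: sz; rewrite s0 size_nseq => ->.
  have := @quad0_in (nseq m 0%N) (IH (size_nseq _ _)); rewrite quad0_word.
  by move=> /in_of_addl; apply; apply/lspanZ/der_in/size_nseq.
(* A letter other than alpha(-1) is brought to the front, so that the weight collected into one
   letter is positive and [top_in] applies. *)
rewrite -has_predC => /hasP[a aS /=]; case: a aS => // a aS _.
have sz' := size_rem aS; move: (perm_to_rem aS) sz'.
rewrite sz; case: (rem _ s) => [|b t] //= /word_perm -> [st].
rewrite word_swap; apply: collect_in => //; rewrite addnS.
exact: top_in.
Qed.

End LongerWords.

Lemma even_word_in s : ~~ odd (size s) -> W (word s).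
Proof.
move=> es; have [n] : exists n, size s = n.*2.
  by exists (size s)./2; rewrite even_halfK.
elim: n s {es} => [|[|n] IH] s.
- by move/size0nil ->.
- by case: s => [|a [|b []]] // _; apply: pair_in.
by apply: (@longer_in n.+1.*2); rewrite ?odd_double.
Qed.

End Reduction.

(** * Quadratic modes with polynomial coefficients and their commutators with L(-2) *)

Section Modes.

(* [mode N f] is the sum of f(u) alpha(-u-1) alpha(-(N-u)-1) over all integers u;
   [mode_coef] collects the terms with u > N or u < 0. *)
Definition mode_coef N (f : {poly F}) (a : nat) : F :=
  a.+1%:R * (f.[(N + a + 2)%:R] + f.[- (a + 2)%:R]).

Definition mode N (f : {poly F}) (v : V) : V :=
  \sum_(u < N.+1) f.[u%:R] *: cr u (cr (N - u) v)
  + kap *: der (mode_coef N f) (N + 2) v.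

Fact mode_is_linear N f : linear (mode N f).
Proof.
move=> c u v; rewrite /mode [in RHS]scalerDr [RHS]addrACA; congr (_ + _).
  rewrite scaler_sumr -big_split; apply: eq_bigr => i _ /=.
  by rewrite 3!linearP.
by rewrite linearP linearP.
Qed.

HB.instance Definition _ N f := GRing.isLinear.Build F V V _ (mode N f) (mode_is_linear N f).

Lemma mode_cr N f a v :
  mode N f (cr a v) = cr a (mode N f v) + (kap * mode_coef N f a) *: cr (a + (N + 2)) v.
Proof.
rewrite /mode linearD linearZ linear_sum /= der_cr scalerDr scalerA addrA.
congr (_ + _ + _); apply: eq_bigr => i _.
by rewrite linearZ /= [in RHS]cr_comm [cr a (cr _ v)]cr_comm.
Qed.

Lemma mode_cons N f a s : mode N f (word (a :: s)) =
  cr a (mode N f (word s)) + (kap * mode_coef N f a) *: word ((a + (N + 2))%N :: s).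
Proof. by rewrite -cr_word mode_cr cr_word. Qed.

Lemma mode_nil N f : mode N f (word [::]) = \sum_(u < N.+1) f.[u%:R] *: word [:: u : nat; N - u]%N.
Proof.
rewrite /mode der_nil scaler0 addr0; apply: eq_bigr => i _.
by rewrite !cr_word.
Qed.

(** [der] is abstract here, so linearity in its symbol is derived from the Leibniz rule, on words
    only. *)
Lemma der_lin c phi psi M s : der (fun a => c * phi a + psi a) M (word s) =
  c *: der phi M (word s) + der psi M (word s).
Proof.
elim: s => [|a s IH]; first by rewrite !der_nil scaler0 addr0.
by rewrite !der_cons IH linearP scalerDr scalerDl scalerA addrACA.
Qed.

Lemma der_ext phi psi M s : phi =1 psi -> der phi M (word s) = der psi M (word s).
Proof. by move=> e; elim: s => [|a s IH]; rewrite ?der_nil // !der_cons IH e. Qed.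

Lemma mode_lin N c f g s :
  mode N (c *: f + g) (word s) = c *: mode N f (word s) + mode N g (word s).
Proof.
rewrite /mode.
rewrite (der_ext (psi := fun a => c * mode_coef N f a + mode_coef N g a)); last first.
  by move=> a; rewrite /mode_coef !hornerD !hornerZ; ring.
rewrite der_lin !scalerDr !scalerA [c * kap]mulrC addrACA; congr (_ + _).
rewrite scaler_sumr -big_split; apply: eq_bigr => i _ /=.
by rewrite hornerD hornerZ scalerDl scalerA.
Qed.

Lemma mode0 N s : mode N 0 (word s) = 0.
Proof.
have := mode_lin N 1 0 0 s; rewrite !scale1r addr0 => /eqP.
by rewrite -subr_eq0 opprD addNKr oppr_eq0 => /eqP.
Qed.

Lemma mode_span N f s :
  lspan (fun v => exists2 t, odd (size t) = odd (size s) & v = word t) (mode N f (word s)).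
Proof.
apply: lspanD; last first.
  apply/lspanZ; apply: lspan_sub (der_span _ _ s) => _ [t st ->].
  by apply: lspan_gen; exists t; rewrite // st.
apply: lspan_sum => i _; apply/lspanZ/lspan_gen; rewrite !cr_word.
by exists [:: i : nat, (N - i)%N & s] => //=; rewrite negbK.
Qed.

(* Comes from [L(-2), alpha(i)] = - i alpha(i-2). *)
Definition next_coef N (f : {poly F}) : {poly F} :=
  ('X - 1%:P) * (f \Po ('X - 2%:P)) + (N.+1%:R%:P - 'X) * f.

Lemma next_coefE N f x :
  (next_coef N f).[x] = (x - 1) * f.[x - 2] + (N.+1%:R - x) * f.[x].
Proof. by rewrite !hornerE !horner_comp !hornerE. Qed.

Lemma size_next_coef N (f : {poly F}) n : (size f <= n)%N -> (size (next_coef N f) <= n.+1)%N.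
Proof.
move=> sf; have sN : (size (N.+1%:R%:P - 'X : {poly F})%R <= 2)%N.
  by rewrite -opprB size_polyN size_XsubC.
have sc : (size (f \Po ('X - 2%:P))%R <= n)%N by rewrite size_comp_poly2 ?size_XsubC.
apply: leq_trans (size_polyD _ _) _; rewrite geq_max; apply/andP; split.
  by apply: leq_trans (size_polyMleq _ _) _; rewrite size_XsubC.
apply: leq_trans (size_polyMleq _ _) _; rewrite -subn1 leq_subLR add1n.
exact: leq_add sN sf.
Qed.

(** This is the Jacobi identity for L(-2), [mode N f] and alpha(-a-1), read off on coefficients. *)
Lemma mode_coef_next N f a : mode_coef (N + 2) (next_coef N f) a =
  (a + N + 3)%:R * mode_coef N f a - a.+1%:R * mode_coef N f (a + 2).
Proof.
rewrite /mode_coef !next_coefE.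
have -> : (N + 2 + a + 2)%:R - 2 = (N + a + 2)%:R :> F by rewrite !natrD; ring.
have -> : - (a + 2)%:R - 2 = - (a + 2 + 2)%:R :> F by rewrite !natrD; ring.
have -> : (N + (a + 2) + 2)%:R = (N + 2 + a + 2)%:R :> F by rewrite !natrD; ring.
by rewrite -![_.+1%:R]natr1 !natrD; ring.
Qed.

Section Commutator.
Context (L : {linear V -> V}).
Context (L_word : forall s, L (word s) = (2 * kap)^-1 *: quad 0 0 0 (word s)).

Lemma L_cons a s : L (word (a :: s)) = cr a (L (word s)) + a.+1%:R *: word ((a + 2)%N :: s).
Proof.
rewrite !L_word !quad0_word der_cons quad_coef0.
rewrite [cr a (_ *: _)]linearZ [cr a (_ + _)]linearD [cr a (kap *: _)]linearZ /= cr_word.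
rewrite [kap *: (_ + _)]scalerDr addrA [LHS]scalerDr; congr (_ *: (_ + _) + _).
  by rewrite -!cr_word [in RHS]cr_comm [cr a (cr 0 _)]cr_comm.
by rewrite !scalerA; congr (_ *: _); field; rewrite natr_neq0 kap_neq0.
Qed.

Lemma L_nil : L (word [::]) = (2 * kap)^-1 *: word [:: 0; 0]%N.
Proof. by rewrite L_word quad0_word der_nil scaler0 addr0. Qed.

(** The restriction on [v] is there because [L] is only known on words, which need not span the
    abstract space. *)
Lemma L_cr a v : lspan (fun w => exists t, w = word t) v ->
  L (cr a v) = cr a (L v) + a.+1%:R *: cr (a + 2) v.
Proof.
pose f : {linear V -> V} := L \o cr a.
pose g : {linear V -> V} := (cr a \o L) \+ (a.+1%:R \*: cr (a + 2)).
apply: (@lspan_eq _ _ _ f g) => _ [t ->] /=.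
by rewrite !cr_word L_cons.
Qed.

Lemma L_pair a b : L (word [:: a; b]) = cr a (cr b (L (word [::])))
  + (b.+1%:R *: word [:: a; b + 2]%N + a.+1%:R *: word [:: a + 2; b]%N).
Proof. by rewrite !L_cons linearD [cr a (_ *: _)]linearZ /= cr_word -addrA. Qed.

Lemma commutator_nil N f :
  L (mode N f (word [::])) = mode N f (L (word [::])) + mode (N + 2) (next_coef N f) (word [::]).
Proof.
have -> : mode N f (L (word [::])) =
    \sum_(u < N.+1) f.[u%:R] *: cr u (cr (N - u) (L (word [::])))
    + mode_coef N f 0 *: word [:: N + 2; 0]%N.
  rewrite {1}/mode; congr (_ + _).
  rewrite L_nil linearZ /= der_pair add0n (word_swap 0 (N + 2)) -scalerDl !scalerA.
  by congr (_ *: _); field; rewrite natr_neq0 kap_neq0.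
rewrite !mode_nil linear_sum.
have -> : \sum_(u < N.+1) L (f.[u%:R] *: word [:: u : nat; N - u]%N) =
  \sum_(u < N.+1) f.[u%:R] *: cr u (cr (N - u) (L (word [::])))
  + (\sum_(u < N.+1) (f.[u%:R] * (N - u).+1%:R) *: word [:: u : nat; N - u + 2]%N
  + \sum_(u < N.+1) (f.[u%:R] * u.+1%:R) *: word [:: u + 2; N - u]%N).
  rewrite -!big_split; apply: eq_bigr => u _ /=.
  by rewrite linearZ /= L_pair !scalerDr !scalerA.
rewrite -addrA; congr (_ + _).
(* The two summands of [next_coef] correspond to L(-2) acting on the second and on the first factor;
   the latter shifts u by 2. *)
have -> : \sum_(u < (N + 2).+1) (next_coef N f).[u%:R] *: word [:: u : nat; N + 2 - u]%N =
  \sum_(u < N.+3) ((N.+1%:R - u%:R) * f.[u%:R]) *: word [:: u : nat; N.+2 - u]%N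
  + \sum_(u < N.+3) ((u%:R - 1) * f.[u%:R - 2]) *: word [:: u : nat; N.+2 - u]%N.
  rewrite addn2 -big_split; apply: eq_bigr => u _ /=.
  by rewrite -scalerDl next_coefE addrC.
(* The boundary terms at u = N+1 and u = 1 have coefficient zero. Those at u = N+2 and u = 0 carry
   -f(N+2) and -f(-2), and cancel the derivation term of [mode N f (L (word [::]))]. *)
rewrite [X in _ = _ + (X + _)]big_ord_recr [X in _ = _ + (X + _ + _)]big_ord_recr /=.
rewrite [X in _ = _ + (_ + X)]big_ord_recl [X in _ = _ + (_ + (_ + X))]big_ord_recl /=.
rewrite !subrr !mul0r !scale0r subnn addr0 add0r.
set S1 := (X in X + _ = _); set S2 := (X in _ + X = _).
have -> : \sum_(i < N.+1) ((N.+1%:R - i%:R) * f.[i%:R]) *: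
    word [:: i : nat; N.+2 - i]%N = S1.
  apply: eq_bigr => i _; have hi := ltn_ord i; rewrite mulrC -natrB; last by lia.
  have -> : (N.+1 - i = (N - i).+1)%N by lia.
  by have -> : (N.+2 - i = N - i + 2)%N by lia.
have -> : \sum_(i < N.+1) (((bump 0 (bump 0 i))%:R - 1) * f.[(bump 0 (bump 0 i))%:R - 2])
    *: word [:: bump 0 (bump 0 i); N.+2 - bump 0 (bump 0 i)]%N = S2.
  apply: eq_bigr => i _; rewrite /bump !add1n !subSS addn2 mulrC; congr (f.[_] * _ *: _).
    by rewrite -addn2 natrD addrK.
  by rewrite -natr1 addrK.
rewrite add0r subn0 (word_swap 0) addn2.
rewrite [RHS](AC (1*(2*2)) (2*5*(1*3*4))) /= -!scalerDl [X in _ + X *: _]( _ : _ = 0).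
  by rewrite scale0r addr0 add0r.
have e : (N + 0 + 2 = N.+2)%N by lia.
by rewrite /mode_coef e add0n -[N.+2%:R]natr1; ring.
Qed.

(** Induction on the word: by [mode_coef_next] both sides change alike when a letter is put in
    front. *)
Lemma commutator N f s :
  L (mode N f (word s)) = mode N f (L (word s)) + mode (N + 2) (next_coef N f) (word s).
Proof.
elim: s => [|a s IH]; first exact: commutator_nil.
rewrite [mode N f (word (a :: s))]mode_cons [mode (N + 2) _ (word (a :: s))]mode_cons.
rewrite linearD [L (_ *: _)]linearZ /= L_cr; last first.
  by apply: lspan_sub (mode_span N f s) => _ [t _ ->]; apply: lspan_gen; exists t.
rewrite IH !L_cons [mode N f (_ + _)]linearD /= [mode N f (_ *: _)]linearZ /= mode_cr mode_cons.
rewrite [cr a (_ + _)]linearD /= !scalerDr !scalerA mode_coef_next.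
have -> : (a + 2 + (N + 2) = a + (N + 2) + 2)%N by lia.
have -> : (a + (N + 2 + 2) = a + (N + 2) + 2)%N by lia.
rewrite [RHS](AC (2*2*2) ((1*5*3)*(2*(4*6)))) /= -scalerDl.
congr (_ + (_ + _ *: _)).
have -> : ((a + (N + 2)).+1 = a + N + 3)%N by lia.
by ring.
Qed.

End Commutator.

(** The binomial coefficient (x choose j) as a polynomial in x, so that negative x are allowed. *)
Fixpoint bin_poly (j : nat) : {poly F} :=
  if j is i.+1 then i.+1%:R^-1 *: (bin_poly i * ('X - i%:R%:P)) else 1.

Lemma size_bin_poly j : (size (bin_poly j) <= j.+1)%N.
Proof.
elim: j => [|j IH] /=; first by rewrite size_poly1.
apply: leq_trans (size_scale_leq _ _) _; apply: leq_trans (size_polyMleq _ _) _.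
by rewrite size_XsubC addn2 /= ltnS.
Qed.

Lemma bin_poly_nat j n : (bin_poly j).[n%:R] = 'C(n, j)%:R.
Proof.
elim: j => [|j IH] /=; first by rewrite bin0 hornerC.
rewrite hornerZ hornerM IH hornerXsubC.
apply: (mulfI (natr_neq0 j)); rewrite mulVKf ?natr_neq0 // -natrM mul_bin_left natrM.
case: (leqP j n) => hj; first by rewrite natrB // mulrC.
by rewrite bin_small // mulr0 mul0r.
Qed.

Lemma bin_poly_neg j n : (bin_poly j).[- n.+1%:R] = (-1) ^+ j * 'C(n + j, j)%:R.
Proof.
elim: j => [|j IH] /=; first by rewrite bin0 hornerC mulr1.
rewrite hornerZ hornerM IH hornerXsubC.
apply: (mulfI (natr_neq0 j)); rewrite mulVKf ?natr_neq0 //.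
transitivity ((-1) ^+ j.+1 * (j.+1%:R * 'C(n + j.+1, j.+1)%:R) : F); last by ring.
rewrite -natrM -mul_bin_diag addnS /= natrM exprS -[(n + j).+1%:R]natr1 -[n.+1%:R]natr1.
by rewrite natrD; ring.
Qed.

(** In the j-th divided derivative of alpha(z), the operator alpha(-u-1) has coefficient (u choose
    j) for every integer u. The two arguments are u and N-u with N = j1+j2+q. *)
Definition quad_poly (j1 j2 q : nat) : {poly F} :=
  bin_poly j1 * (bin_poly j2 \Po ((j1 + j2 + q)%:R%:P - 'X)).

Lemma size_quad_poly j1 j2 q : (size (quad_poly j1 j2 q) <= (j1 + j2).+1)%N.
Proof.
have s2 : size ((j1 + j2 + q)%:R%:P - 'X : {poly F}) = 2%N.
  by rewrite -opprB size_polyN size_XsubC.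
apply: leq_trans (size_polyMleq _ _) _; rewrite size_comp_poly2 //.
rewrite -subn1 leq_subLR add1n -addSn -addnS.
exact: leq_add (size_bin_poly _) (size_bin_poly _).
Qed.

Lemma quad_polyE j1 j2 q x :
  (quad_poly j1 j2 q).[x] = (bin_poly j1).[x] * (bin_poly j2).[(j1 + j2 + q)%:R - x].
Proof. by rewrite hornerM horner_comp hornerD hornerN hornerX hornerC. Qed.

Lemma quad_poly_nat j1 j2 q u : (u <= j1 + j2 + q)%N ->
  (quad_poly j1 j2 q).[u%:R] = 'C(u, j1)%:R * 'C(j1 + j2 + q - u, j2)%:R.
Proof. by move=> hu; rewrite quad_polyE -natrB // !bin_poly_nat. Qed.

Lemma mode_coef_quad_poly j1 j2 q :
  mode_coef (j1 + j2 + q) (quad_poly j1 j2 q) =1 quad_coef j1 j2 q.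
Proof.
move=> a; rewrite /mode_coef /quad_coef !quad_polyE.
have -> : (j1 + j2 + q)%:R - (j1 + j2 + q + a + 2)%:R = - a.+2%:R :> F.
  by rewrite -[a.+2]addn2 !natrD; ring.
have -> : (j1 + j2 + q)%:R - - (a + 2)%:R = (j1 + j2 + q + a + 2)%:R :> F.
  by rewrite !natrD; ring.
rewrite (addn2 a) !bin_poly_nat !bin_poly_neg.
have -> : (j1 + j2 + q + a + 2 = a + q + j1 + j2 + 2)%N by lia.
have -> : (a.+1 + j2 = a + 1 + j2)%N by lia.
have -> : (a.+1 + j1 = j1 + a + 1)%N by lia.
by ring.
Qed.

Lemma quad_mode j1 j2 q s :
  quad j1 j2 q (word s) = mode (j1 + j2 + q) (quad_poly j1 j2 q) (word s).
Proof.
rewrite /quad /mode -(der_ext _ _ (mode_coef_quad_poly j1 j2 q)); congr (_ + _).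
rewrite -(big_mkord xpredT (fun u => (quad_poly j1 j2 q).[u%:R] *:
  cr u (cr (j1 + j2 + q - u) (word s)))).
(* One of the two binomials vanishes for u < j1 and for u > j1+q, which leaves the q+1 terms of
   [quad]. *)
rewrite (big_cat_nat (n := j1)) /=; [|lia|lia].
rewrite (big_cat_nat (m := j1) (n := j1 + q.+1)) /=; [|lia|lia].
rewrite [X in _ = X + _]big_nat [X in _ = X + _]big1 ?add0r => [|u hu]; last first.
  have u1 : (u < j1)%N by lia.
  by rewrite quad_poly_nat ?(bin_small u1) ?mul0r ?scale0r //; lia.
rewrite [X in _ = _ + X]big_nat [X in _ = _ + X]big1 ?addr0 => [|u hu]; last first.
  have u2 : (j1 + j2 + q - u < j2)%N by lia.
  by rewrite quad_poly_nat ?(bin_small u2) ?mulr0 ?scale0r //; lia.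
have shift (H : nat -> V) m n : \sum_(m <= u < m + n) H u = \sum_(i < n) H (i + m)%N.
  by rewrite -{1}[m]add0n big_addn addKn big_mkord.
rewrite shift; apply: eq_bigr => i _.
have hi := ltn_ord i; rewrite quad_poly_nat; last by lia.
have -> : (j1 + j2 + q - (i + j1) = j2 + (q - i))%N by lia.
have bin_comm m n : 'C(m + n, n) = 'C(m + n, m).
  by rewrite -(bin_sub (leq_addr n m)) addKn.
by rewrite (bin_comm j1) (bin_comm j2) [(i + j1)%N]addnC.
Qed.

Lemma natr_inj : injective (fun n => n%:R : F).
Proof.
have lt_neq i j : (i < j)%N -> i%:R = j%:R :> F -> false.
  move=> h /esym /eqP; rewrite -subr_eq0 -natrB; last exact: ltnW.
  by rewrite ((pcharf0P F).1 charF) subn_eq0 leqNgt h.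
by move=> i j; case: (ltngtP i j) => // h => [|/esym] /(lt_neq _ _ h).
Qed.

(** The index q = 1 stands for the mode number -2 that defines C_2. *)
Definition c2_mode (v : V) : Prop :=
  exists2 s, ~~ odd (size s) & exists a b, v = quad a b 1 (word s).

(* Among the points 0, ..., N the polynomial [quad_poly e (N - 1 - e) 1] is nonzero
   only at e and e + 1, so these polynomials interpolate [f] triangularly. *)
Lemma mode_in_vanishing N (f : {poly F}) s d : ~~ odd (size s) -> (d <= N)%N ->
  (size f <= N)%N -> (forall u, (u < N - d)%N -> f.[u%:R] = 0) ->
  lspan c2_mode (mode N f (word s)).
Proof.
move=> es; elim: d f => [|d IH] f hd sf f0.
  (* The polynomial has degree below N and vanishes at 0, ..., N-1. *)
  have -> : f = 0.
    pose rs := [seq i%:R : F | i <- iota 0 N].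
    apply: (@roots_geq_poly_eq0 _ _ rs).
    - apply/allP => x /mapP[i]; rewrite mem_iota add0n => /andP[_ hi] ->{x}.
      by apply/rootP/f0; rewrite subn0.
    - by rewrite map_inj_uniq ?iota_uniq //; apply: natr_inj.
    - by rewrite size_map size_iota.
  by rewrite mode0; apply: lspan0.
pose e := (N - d.+1)%N.
have eN : (e + d + 1 = N)%N by rewrite /e; lia.
(* The divisor d+1 is the value of [p] at e. *)
pose c := f.[e%:R] / d.+1%:R; pose p := quad_poly e d 1.
have -> : f = c *: p + (f - c *: p) by rewrite addrCA subrr addr0.
rewrite mode_lin; apply: lspanD.
  by apply/lspanZ/lspan_gen; exists s => //; exists e, d; rewrite quad_mode eN.
apply: IH; first by lia.
  apply: leq_trans (size_polyD _ _) _; rewrite geq_max sf size_polyN.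
  apply: leq_trans (size_scale_leq _ _) _; apply: leq_trans (size_quad_poly _ _ _) _; lia.
move=> u hu; rewrite hornerD hornerN hornerZ quad_poly_nat; last by lia.
case: (ltnP u e) => he; first by rewrite f0 ?(bin_small he) ?mul0r ?mulr0 ?subr0 //; lia.
have -> : u = e by lia.
have -> : (e + d + 1 - e = d.+1)%N by lia.
by rewrite binn mul1r binSn /c divfK ?natr_neq0 ?subrr.
Qed.

Lemma mode_in N (f : {poly F}) s : ~~ odd (size s) -> (size f <= N)%N ->
  lspan c2_mode (mode N f (word s)).
Proof. by move=> es sf; apply: (@mode_in_vanishing N f s N) => // u; rewrite subnn. Qed.

(** Degree count: for N = a+b+1 the polynomial has size at most N. Commuting with L(-2) gives size
    at most N+1 at level N+2, still within the range of [mode_in]. *)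
Lemma c2_mode_L (L : {linear V -> V}) v :
  (forall s, L (word s) = (2 * kap)^-1 *: quad 0 0 0 (word s)) ->
  c2_mode v -> lspan c2_mode (L v).
Proof.
move=> L_word [s es [a [b ->]]]; rewrite quad_mode (commutator L_word); apply: lspanD.
  have : lspan (fun w => exists2 t, odd (size t) = odd (size s) & w = word t) (L (word s)).
    by rewrite L_word quad_mode; apply/lspanZ/mode_span.
  apply: lspan_map => _ [t et ->]; apply: mode_in; first by rewrite et.
  by apply: leq_trans (size_quad_poly _ _ _) _; lia.
apply: mode_in => //; apply: leq_trans (size_next_coef _ (size_quad_poly _ _ _)) _; lia.
Qed.

End Modes.
End BosonicFock.

(** * The charge zero sector of the lattice vertex algebra *)

Section Fock.
Context (F : fieldType) (k : nat).
Local Notation V := (VL F).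

Lemma linextE (f : VLbasis -> V) (d : {fset VLbasis}) (v : V) :
  (msupp v `<=` d)%fset -> linext f v = \sum_(b <- d) v@_b *: f b.
Proof.
move=> le; rewrite /linext; apply/big_fset_incl => //= b _ /mcoeff_outdom ->.
by rewrite scale0r.
Qed.

Fact linext_is_linear (f : VLbasis -> V) : linear (linext f).
Proof.
move=> a u v; pose d := (msupp u `|` msupp v)%fset.
have hu : (msupp u `<=` d)%fset by exact: fsubsetUl.
have hv : (msupp v `<=` d)%fset by exact: fsubsetUr.
have hw : (msupp (a *: u + v) `<=` d)%fset.
  apply: fsubset_trans (msuppD_le _ _) _; rewrite fsubUset hv andbT.
  exact: fsubset_trans (msuppZ_le _ _) hu.
rewrite (linextE f hu) (linextE f hv) (linextE f hw) scaler_sumr -big_split /=.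
by apply: eq_bigr => b _; rewrite mcoeffD mcoeffZ scalerDl scalerA.
Qed.

HB.instance Definition _ (f : VLbasis -> V) :=
  GRing.isLinear.Build F V V _ (linext f) (linext_is_linear f).
HB.instance Definition _ (n : int) := GRing.Linear.copy (heis k n) (linext (heis_b F k n)).
HB.instance Definition _ := GRing.Linear.copy (@theta F) (linext (@theta_b F)).

Lemma linext_bvec (f : VLbasis -> V) b : linext f (bvec F b) = f b.
Proof.
by rewrite /linext /bvec msuppU oner_eq0 big_seq_fset1 mcoeffUU scale1r.
Qed.

Lemma bvec_sum (v : V) : v = \sum_(b <- msupp v) v@_b *: bvec F b.
Proof.
rewrite {1}(monalgE v); apply: eq_bigr => b _; apply/malgP => c.
by rewrite /bvec mcoeffZ [LHS]mcoeffU [in RHS]mcoeffU mulr_natr.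
Qed.

Lemma linear_ext (f g : {linear V -> V}) :
  (forall b, f (bvec F b) = g (bvec F b)) -> f =1 g.
Proof.
move=> fg v; rewrite (bvec_sum v).
have E (h : {linear V -> V}) : h (\sum_(b <- msupp v) v@_b *: bvec F b) =
    \sum_(b <- msupp v) v@_b *: h (bvec F b).
  by rewrite linear_sum; apply: eq_bigr => b _; rewrite linearZ.
by rewrite (E f) (E g); apply: eq_bigr => b _; rewrite fg.
Qed.

Fact Ymode_is_linear (v : V) p : linear (Ymode k v p).
Proof.
move=> a u w; rewrite /Ymode scaler_sumr -big_split; apply: eq_bigr => b _ /=.
by rewrite linearP scalerDr !scalerA mulrC.
Qed.

HB.instance Definition _ (v : V) p :=
  GRing.isLinear.Build F V V _ (Ymode k v p) (Ymode_is_linear v p).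
HB.instance Definition _ n := GRing.Linear.copy (@Lop F k n) (Ymode k (omega F k) (n + 1)).

Lemma Ymode_linext p w v :
  Ymode k v p w = linext (fun b => linext (@modeB F k (enum_mset b.1) b.2 p) w) v.
Proof. by []. Qed.

Lemma YmodeZ a (u w : V) p : Ymode k (a *: u) p w = a *: Ymode k u p w.
Proof. by rewrite !Ymode_linext linearZ. Qed.

Definition word (s : seq nat) : V := bvec F (seq_mset s, 0).

Definition cr (a : nat) : V -> V := heis k (- a.+1%:Z).
HB.instance Definition _ a := GRing.Linear.copy (cr a) (heis k (- a.+1%:Z)).

Lemma word_perm s t : perm_eq s t -> word s = word t.
Proof. by move/eq_seq_msetP; rewrite /word => ->. Qed.

Lemma word_enum (A : multiset nat) : word (enum_mset A) = bvec F (A, 0).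
Proof. by rewrite /word seq_mset_id. Qed.

Lemma seq_mset_cons (a : nat) s : seq_mset (a :: s) = (a +` seq_mset s)%mset.
Proof. by apply/msetP => b; rewrite mset_seqE mset1DE mset_seqE /= eq_sym. Qed.

Lemma seq_mset0 : seq_mset [::] = mset0 :> multiset nat.
Proof. by apply/msetP => b; rewrite mset_seqE mset0E. Qed.

Lemma vac_word : vac F = word [::].
Proof. by rewrite /word seq_mset0. Qed.

Lemma cr_bvec a (A : multiset nat) m : cr a (bvec F (A, m)) = bvec F ((a +` A)%mset, m).
Proof. by rewrite /cr /heis linext_bvec. Qed.

Lemma cr_word a s : cr a (word s) = word (a :: s).
Proof. by rewrite cr_bvec /word seq_mset_cons. Qed.

Lemma cr_comm a b v : cr a (cr b v) = cr b (cr a v).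
Proof.
apply: (linear_ext (f := cr a \o cr b) (g := cr b \o cr a)) => -[A m] /=.
apply: etrans (congr1 (cr a) (cr_bvec b A m)) _.
apply: etrans (cr_bvec a _ m) _; apply/esym.
apply: etrans (congr1 (cr b) (cr_bvec a A m)) _.
by apply: etrans (cr_bvec b _ m) _; rewrite msetDCA.
Qed.

Definition der_b (phi : nat -> F) (M : nat) (b : VLbasis) : V :=
  \sum_(a <- enum_mset b.1) phi a *: bvec F (((a + M)%N +` (b.1 `\ a))%mset, b.2).
Definition der phi M : V -> V := linext (der_b phi M).
HB.instance Definition _ phi M := GRing.Linear.copy (der phi M) (linext (der_b phi M)).

Lemma perm_enum_mset1D (a : nat) (A : multiset nat) :
  perm_eq (enum_mset (a +` A)%mset) (a :: enum_mset A).
Proof.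
by apply/allP => b _ /=; rewrite !count_mem_mset mset1DE [b == a]eq_sym.
Qed.

Lemma der_cr phi M a v :
  der phi M (cr a v) = cr a (der phi M v) + phi a *: cr (a + M) v.
Proof.
apply: (linear_ext (f := der phi M \o cr a)
  (g := (cr a \o der phi M) \+ (phi a \*: cr (a + M)))) => -[A m] /=.
apply: etrans (congr1 (der phi M) (cr_bvec a A m)) _.
apply: etrans (linext_bvec _ _) _; rewrite {1}/der_b /=.
rewrite (perm_big _ (perm_enum_mset1D a A)) big_cons /= msetD1K addrC.
apply: (congr2 +%R); last exact: congr1 (esym (cr_bvec _ A m)).
apply/esym; apply: etrans (congr1 (cr a) (linext_bvec _ _)) _.
rewrite linear_sum /=; apply: eq_big_seq => b bA.
rewrite linearZ /=; congr (_ *: _).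
apply: etrans (cr_bvec a _ m) _; congr (bvec F (_, m)).
apply/msetP => c; rewrite !mset1DE !msetB1E !mset1DE.
have : (0 < A b)%N by rewrite -in_mset.
by case: (c =P b) => [->|_]; lia.
Qed.

Lemma der_vac phi M : der phi M (word [::]) = 0.
Proof. by rewrite /der linext_bvec /der_b /= seq_mset0 enum_mset0 big_nil. Qed.

(** * Vertex operator modes at charge zero *)

Lemma heis_ann (i : nat) (A : multiset nat) :
  heis k i%:Z (bvec F (A, 0)) =
  (2 * k * i * A i.-1)%:R *: bvec F ((A `\ i.-1)%mset, 0).
Proof.
(* At i = 0 the operator alpha(0) acts by zero, and the factor i makes the truncated [i.-1]
   harmless. *)
apply: etrans (linext_bvec _ _) _; case: i => [|i]; last by [].
by rewrite /heis_b ltxx eqxx mulr0 scale0r muln0 mul0n scale0r.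
Qed.

Lemma linext_heis_ann (f : VLbasis -> V) (i : nat) (A : multiset nat) :
  linext f (heis k i%:Z (bvec F (A, 0))) =
  (2 * k * i * A i.-1)%:R *: f ((A `\ i.-1)%mset, 0).
Proof. by rewrite heis_ann linearZ /= linext_bvec. Qed.

(** At charge zero the exponentials are the identity, so only their constant coefficient
    survives. *)
Lemma Splus0 d (w : V) : Splus k 0 d d w = if d == 0%N then w else 0.
Proof.
case: d => [|d] //=; rewrite big1 ?scaler0 // => j _.
by rewrite oppr0 scale0r.
Qed.

Lemma Sminus0 d (w : V) : Sminus k 0 d d w = if d == 0%N then w else 0.
Proof. by case: d => [|d] //=; rewrite big1 ?scaler0 // => j _; rewrite scale0r. Qed.

Lemma modeB_nil p (A : multiset nat) :
  modeB F k [::] 0 p (A, 0) = if p == -1 then bvec F (A, 0) else 0.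
Proof.
rewrite /= big_ord_recl big1 ?addr0; last first.
  by move=> i _; rewrite Splus0 /= Sminus0 if_same; case: ifP.
rewrite !mulr0 !addr0 Splus0 /= Sminus0.
case: (p =P -1) => [->|np]; first by [].
have -> : (`|(0%Z - p - 1)%R|%N == 0%N) = false by lia.
by rewrite if_same.
Qed.

Lemma modeB_cons j s p (A : multiset nat) :
  modeB F k (j :: s) 0 p (A, 0) =
  \sum_(i < (wtB k (seq_mset s, 0) + wtB k (A, 0) + `|p|).+1)
    ('C(j + i, i)%:R *: cr (j + i) (modeB F k s 0 (p + i%:Z) (A, 0))
     + ((-1) ^+ j * 'C(j + i, i)%:R * (2 * k * i * A i.-1)%:R) *:
         modeB F k s 0 (p - (j.+1 + i)%N%:Z) ((A `\ i.-1)%mset, 0)).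
Proof.
apply: eq_bigr => i _; rewrite scalerBr; apply: (congr2 +%R); first exact: erefl.
apply: etrans (congr1 (fun v => - (_ *: (_ *: v))) (linext_heis_ann _ _ _)) _.
rewrite -scalerN -scaleNr 2!scalerA; apply: (congr1 (fun c => c *: _)).
by rewrite exprS mulN1r opprK [_ * (-1) ^+ j]mulrC.
Qed.

#[local] Arguments modeB : simpl never.

(** The vacuum field has only the mode -1, so one index of the iterate formula survives: i = q in
    the creation half here, i = n-j in the annihilation half in [modeB1_pos]. *)
Lemma modeB1_neg j q (A : multiset nat) :
  modeB F k [:: j] 0 (- q.+1%:Z) (A, 0) =
  'C(j + q, q)%:R *: cr (j + q) (bvec F (A, 0)).
Proof.
rewrite modeB_cons.
have hq : (q < (wtB k (seq_mset [::], 0%Z) + wtB k (A, 0%Z) + `|- q.+1%:Z|).+1)%N by lia.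
rewrite (bigD1 (Ordinal hq)) //= big1 ?addr0 => [|i /eqP ni].
  rewrite !modeB_nil.
  have -> : (- q.+1%:Z + q%:Z == -1) = true by lia.
  have -> : (- q.+1%:Z - (j.+1 + q)%N%:Z == -1) = false by lia.
  by rewrite scaler0 addr0.
have {ni} ni : (i : nat) <> q by move=> e; apply: ni; apply: val_inj.
rewrite !modeB_nil.
have -> : (- q.+1%:Z + i%:Z == -1) = false by lia.
have -> : (- q.+1%:Z - (j.+1 + i)%N%:Z == -1) = false by lia.
by rewrite linear0 !scaler0 addr0.
Qed.

Lemma modeB1_pos j n (A : multiset nat) :
  modeB F k [:: j] 0 n%:Z (A, 0) =
  if (j <= n)%N then ((-1) ^+ j * 'C(n, j)%:R) *: heis k (n - j)%N%:Z (bvec F (A, 0))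
  else 0.
Proof.
rewrite modeB_cons; case: leqP => hj; last first.
  rewrite big1 // => i _; rewrite !modeB_nil.
  have -> : (n%:Z + i%:Z == -1) = false by lia.
  have -> : (n%:Z - (j.+1 + i)%N%:Z == -1) = false by lia.
  by rewrite linear0 !scaler0 addr0.
have hq : (n - j < (wtB k (seq_mset [::], 0%Z) + wtB k (A, 0%Z) + `|n%:Z|).+1)%N by lia.
rewrite (bigD1 (Ordinal hq)) //= big1 ?addr0 => [|i /eqP ni].
  rewrite !modeB_nil.
  have -> : (n%:Z + (n - j)%N%:Z == -1) = false by lia.
  have -> : (n%:Z - (j.+1 + (n - j))%N%:Z == -1) = true by lia.
  rewrite linear0 scaler0 add0r.
  apply: etrans _ (congr1 (fun v => _ *: v) (esym (heis_ann _ _))).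
  apply: etrans _ (esym (scalerA _ _ _)); apply: (congr1 (fun c => c *: _)).
  by rewrite (subnKC hj) bin_sub.
have {ni} ni : (i : nat) <> (n - j)%N by move=> e; apply: ni; apply: val_inj.
rewrite !modeB_nil.
have -> : (n%:Z + i%:Z == -1) = false by lia.
have -> : (n%:Z - (j.+1 + i)%N%:Z == -1) = false by lia.
by rewrite linear0 !scaler0 addr0.
Qed.

Lemma sum_enum_mset (A : multiset nat) (G : nat -> V) B :
  (forall a, a \in A -> (a < B)%N) ->
  \sum_(a <- enum_mset A) G a = \sum_(a < B) (A a)%:R *: G a.
Proof.
move=> hB; rewrite big_mset.
have -> : \sum_(a < B) (A a)%:R *: G a = \sum_(a <- iota 0 B) (A a)%:R *: G a.
  by rewrite -(big_mkord xpredT (fun a => (A a)%:R *: G a)) /index_iota subn0.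
have eG a : iterop (A a) +%R (G a) 0 = (A a)%:R *: G a.
  rewrite Monoid.iteropE scaler_nat; elim: (A a) => [|n IH]; first by [].
  by rewrite mulrS -IH.
rewrite (eq_bigr _ (fun a _ => eG a)) /= [RHS](bigID (mem (finsupp A))) /=.
rewrite [X in _ = _ + X]big1 ?addr0 => [|a]; last first.
  by rewrite mem_finsupp negbK => /eqP ->; rewrite scale0r.
rewrite -[RHS]big_filter; apply: perm_big; apply: uniq_perm.
- exact: fset_uniq.
- by rewrite filter_uniq ?iota_uniq.
move=> a; rewrite mem_filter mem_iota /= add0n.
by case: (boolP (a \in finsupp A)) => //= aA; rewrite hB // -msuppE.
Qed.

(** Since alpha(a+1) acts as 2k(a+1) d/d alpha(-a-1), annihilating a letter and creating another is
    a derivation. *)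
Lemma sum_cr_heis (phi : nat -> F) M (A : multiset nat) B :
  (forall a, a \in A -> (a < B)%N) ->
  \sum_(a < B) (phi a * (2 * k * a.+1 * A a)%:R) *:
      cr (a + M) (bvec F ((A `\ nat_of_ord a)%mset, 0)) =
  (2 * k)%:R *: der (fun a => a.+1%:R * phi a) M (bvec F (A, 0)).
Proof.
move=> hB.
apply: etrans _ (congr1 (fun v => _ *: v) (esym (linext_bvec _ _))).
rewrite /der_b /= (sum_enum_mset _ hB) scaler_sumr; apply: eq_bigr => a _.
apply: etrans (congr1 (fun v => _ *: v) (cr_bvec _ _ _)) _.
apply/esym; apply: etrans (congr1 (fun v => _ *: v) (scalerA _ _ _)) _.
apply: etrans (scalerA _ _ _) _; apply: (congr1 (fun c => c *: _)).
by rewrite !natrM; ring.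
Qed.

Lemma wtB_bound (A : multiset nat) a : a \in A -> (a < wtB k (A, 0%Z))%N.
Proof.
move=> aA; rewrite /wtB /= (big_rem a) //=; lia.
Qed.

Lemma wtB1 j : wtB k (seq_mset [:: j], 0%Z) = j.+1.
Proof.
by rewrite /wtB /= seq_mset_cons seq_mset0 msetD0 enum_msetn /= big_seq1 muln0 addn0.
Qed.

Lemma modeB2_neg j1 j2 q (A : multiset nat) :
  modeB F k [:: j1; j2] 0 (- q.+1%:Z) (A, 0) =
  \sum_(i < q.+1) ('C(j1 + i, i)%:R * 'C(j2 + (q - i), q - i)%:R) *:
     cr (j1 + i) (cr (j2 + (q - i)) (bvec F (A, 0)))
  + (2 * k)%:R *: der (fun a => a.+1%:R *
     ((-1) ^+ j2 * 'C(a + q + j1 + j2 + 2, j1)%:R * 'C(a + 1 + j2, j2)%:R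
      + (-1) ^+ j1 * 'C(j1 + a + 1, j1)%:R * 'C(a + q + j1 + j2 + 2, j2)%:R))
       (j1 + j2 + q + 2) (bvec F (A, 0)).
Proof.
rewrite modeB_cons big_split /=.
rewrite wtB1; set W := wtB k (A, 0).
(* For i <= q the inner mode creates, for the next j2+1 indices it vanishes (the last of them is
   alpha(0)), and beyond that it annihilates. *)
have -> : (j2.+1 + W + `|- q.+1%:Z|).+1 = (q.+1 + (j2.+1 + W.+1))%N by lia.
rewrite [X in X + _]big_split_ord /= -addrA; apply: (congr2 +%R).
  apply: eq_bigr => i _; have hi := ltn_ord i.
  have -> : - q.+1%:Z + i%:Z = - (q - i).+1%:Z by lia.
  by rewrite modeB1_neg linearZ /= scalerA.
rewrite [X in X + _]big_split_ord /= [X in X + _ + _]big1 ?add0r => [|i _]; last first.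
  have -> : - q.+1%:Z + (q.+1 + i)%N%:Z = i%:Z by lia.
  rewrite modeB1_pos; case: leqP => hi; last by rewrite linear0 scaler0.
  have -> : (i - j2 = 0)%N by have := ltn_ord i; lia.
  by rewrite heis_ann muln0 mul0n scale0r scaler0 linear0 scaler0.
(* In the other half i = 0 gives alpha(0), and the last q+1+j2 indices exceed every letter of [A].
   Both halves are then sums over the same W+1 letters. *)
have -> : (q.+1 + (j2.+1 + W.+1) = 1 + (W.+1 + (q.+1 + j2)))%N by lia.
have hW a : a \in A -> (a < W.+1)%N by move=> /wtB_bound /leqW.
rewrite [X in _ + X]big_split_ord /= [X in _ + (X + _)]big1 ?add0r => [|i _]; last first.
  by rewrite (ord1 i) muln0 mul0n mulr0 scale0r.
rewrite [X in _ + X]big_split_ord /=.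
have Z (i : 'I_(q.+1 + j2)) : A (0 + (W.+1 + i))%N = 0%N.
  by apply/eqP; rewrite mset_eq0; apply/negP => /hW; lia.
apply: etrans (congr1 (fun v => _ + (_ + v)) (big1 _ _ _ _)) _.
  by move=> i _; rewrite Z muln0 mulr0 scale0r.
apply: etrans (congr1 (fun v => _ + v) (addr0 _)) _.
apply: etrans _ (sum_cr_heis _ _ hW); rewrite -big_split; apply: eq_bigr => a _ /=.
have -> : - q.+1%:Z + (q.+1 + (j2.+1 + a))%N%:Z = (j2.+1 + a)%N%:Z by lia.
have -> : - q.+1%:Z - (j1.+1 + (1 + a))%N%:Z = - (q + j1 + a + 2).+1%:Z by lia.
rewrite modeB1_pos ifT ?modeB1_neg; last by lia.
have -> : (j2.+1 + a - j2 = a.+1)%N by lia.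
have -> : (0 + a = a)%N by lia.
rewrite linearZ /=.
apply: etrans (congr2 (fun v w => _ *: (_ *: v) + w)
  (congr1 (cr _) (heis_ann a.+1 A)) (erefl _)) _.
rewrite linearZ /= !scalerA [X in _ *: X + _]linearZ /= scalerA.
have -> : (j1 + (q.+1 + (j2.+1 + a)) = a + (j1 + j2 + q + 2))%N by lia.
have -> : (j2 + (q + j1 + a + 2) = a + (j1 + j2 + q + 2))%N by lia.
apply: etrans (esym (scalerDl _ _ _)) _; apply: (congr1 (fun c => c *: _)).
have -> : 'C(a + (j1 + j2 + q + 2), q.+1 + (j2.+1 + a)) = 'C(a + q + j1 + j2 + 2, j1).
  by rewrite -bin_sub; [congr 'C(_, _)|]; lia.
have -> : 'C(j1 + (1 + a), 1 + a) = 'C(j1 + a + 1, j1).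
  by rewrite -bin_sub; [congr 'C(_, _)|]; lia.
have -> : 'C(a + (j1 + j2 + q + 2), q + j1 + a + 2) = 'C(a + q + j1 + j2 + 2, j2).
  by rewrite -bin_sub; [congr 'C(_, _)|]; lia.
have -> : (j2.+1 + a = a + 1 + j2)%N by lia.
by rewrite add1n; ring.
Qed.

Definition cr_op a : {linear V -> V} := cr a.
Definition der_op phi M : {linear V -> V} := der phi M.

Local Notation Q := (quad (2 * k)%:R cr_op der_op).

Lemma cr_op_word a s : cr_op a (word s) = word (a :: s).
Proof. exact: cr_word. Qed.

Lemma cr_op_comm a b v : cr_op a (cr_op b v) = cr_op b (cr_op a v).
Proof. exact: cr_comm. Qed.

Lemma der_op_cr phi M a v : der_op phi M (cr_op a v) =
  cr_op a (der_op phi M v) + phi a *: cr_op (a + M) v.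
Proof. exact: der_cr. Qed.

Lemma Ymode_word s p t :
  Ymode k (word s) p (word t) = modeB F k (enum_mset (seq_mset s)) 0 p (seq_mset t, 0).
Proof.
apply: etrans (Ymode_linext _ _ _) _; apply: etrans (linext_bvec _ _) _.
exact: linext_bvec.
Qed.

Lemma modeB_quad j1 j2 q s :
  modeB F k [:: j1; j2] 0 (- q.+1%:Z) (seq_mset s, 0) = Q j1 j2 q (word s).
Proof. exact: modeB2_neg. Qed.

Lemma Ymode_quad j1 j2 q s :
  Ymode k (word [:: j1; j2]) (- q.+1%:Z) (word s) = Q j1 j2 q (word s).
Proof.
apply: etrans (Ymode_word _ _ _) _.
have : perm_eq (enum_mset (seq_mset [:: j1; j2])) [:: j1; j2] by apply: perm_eq_seq_mset.
case: (enum_mset _) => [|a [|b [|c r]]] h; try by have := perm_size h.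
apply: etrans (modeB_quad _ _ _ _) _.
have : a \in [:: j1; j2] by rewrite -(perm_mem h) mem_head.
(* The enumeration is in the given order or reversed; [quad_swap] settles the second case. *)
rewrite !inE => /orP[] /eqP ea; subst a.
  by move: h; rewrite perm_cons => /perm_mem /(_ b); rewrite !inE eqxx => /esym /eqP ->.
have /perm_mem /(_ b) : perm_eq [:: b] [:: j1].
  by rewrite -(perm_cons j2); apply: perm_trans h _; rewrite (perm_catC [:: j1] [:: j2]).
rewrite !inE eqxx => /esym /eqP ->.
exact: (quad_swap _ cr_op_word cr_op_comm der_vac der_op_cr).
Qed.

(** The creation property. The vacuum has no letter to annihilate, and by induction only i = 0
    survives in the creation half. *)
Lemma modeB_vac s (n : int) : (-1 <= n) ->
  modeB F k s 0 n (seq_mset [::], 0) = if n == -1 then word s else 0.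
Proof.
elim: s n => [|j s IH] n hn; first exact: modeB_nil.
rewrite modeB_cons.
have E (i : nat) : (2 * k * i * (seq_mset [::] : multiset nat) i.-1)%:R = 0 :> F.
  by rewrite mset_seqE muln0.
have {E} -> : \sum_(i < (wtB k (seq_mset s, 0%Z) + wtB k (seq_mset [::], 0%Z) + `|n|).+1)
    ('C(j + i, i)%:R *: cr (j + i) (modeB F k s 0 (n + i%:Z) (seq_mset [::], 0))
     + ((-1) ^+ j * 'C(j + i, i)%:R
         * (2 * k * i * (seq_mset [::] : multiset nat) i.-1)%:R) *:
         modeB F k s 0 (n - (j.+1 + i)%N%:Z) ((seq_mset [::] `\ i.-1)%mset, 0)) =
  \sum_(i < (wtB k (seq_mset s, 0%Z) + wtB k (seq_mset [::], 0%Z) + `|n|).+1)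
    'C(j + i, i)%:R *: cr (j + i) (modeB F k s 0 (n + i%:Z) (seq_mset [::], 0)).
  apply: eq_bigr => i _; rewrite E mulr0.
  by apply: etrans (congr1 (fun v => _ + v) (scale0r _)) (addr0 _).
apply: etrans (big_ord_recl _ _) _.
apply: etrans (congr1 (fun v => _ + v) (big1 _ _ _ _)) _.
  move=> i _; rewrite IH; last by lia.
  have -> : (n + (lift ord0 i)%:Z == -1) = false by rewrite /= /bump /=; lia.
  by rewrite linear0 scaler0.
apply: etrans (addr0 _) _.
rewrite IH; last by lia.
have -> : n + (ord0 : 'I_(wtB k (seq_mset s, 0%Z)
  + wtB k (seq_mset [::], 0%Z) + `|n|).+1)%:Z = n by rewrite /=; lia.
case: eqP => _; last by rewrite linear0 scaler0.
by rewrite /= addn0 bin0 scale1r cr_word.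
Qed.

Lemma Ymode_vac s : Ymode k (word s) (-1) (word [::]) = word s.
Proof.
apply: etrans (Ymode_word _ _ _) _.
apply: etrans (@modeB_vac _ (-1) isT) _.
exact: word_enum.
Qed.

(** * Fixed points of the involution, the space C_2 and the spanning statement *)

Lemma theta_word s : theta (word s) = (-1) ^+ size s *: word s.
Proof.
apply: etrans (linext_bvec _ _) _; rewrite /theta_b /= oppr0.
by rewrite (perm_size (perm_eq_seq_mset s)).
Qed.

Lemma VLplus_word s : ~~ odd (size s) -> VLplus (word s).
Proof.
move=> es; apply: etrans (theta_word s) _.
by rewrite -signr_odd (negPf es) expr0 scale1r.
Qed.

Lemma C2_0 : C2 k (0 : V).
Proof. by exists [::]; split=> //; rewrite big_nil. Qed.

Lemma C2P c (u v : V) : C2 k u -> C2 k v -> C2 k (c *: u + v).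
Proof.
move=> [r [hr ->]] [r' [hr' ->]].
exists ([seq (c *: ab.1, ab.2) | ab <- r] ++ r'); split.
  move=> ab; rewrite mem_cat => /orP[/mapP[[a b] /hr [/= ha hb] ->]|/hr' //].
  by split=> //=; rewrite /VLplus linearZ /= ha.
rewrite big_cat big_map /= scaler_sumr; congr (_ + _); apply: eq_bigr => ab _.
exact: esym (YmodeZ _ _ _ _).
Qed.

Lemma C2_mode_in v : c2_mode (2 * k)%:R word cr_op der_op v -> C2 k v.
Proof.
move=> [s es [a [b ->]]]; exists [:: (word [:: a; b], word s)]; split.
  by move=> ab; rewrite inE => /eqP -> /=; split; apply: VLplus_word.
by rewrite big_seq1 /= -Ymode_quad.
Qed.

Lemma linext_span (G : V -> Prop) (f : VLbasis -> V) (v : V) :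
  (forall b, b \in msupp v -> lspan G (f b)) -> lspan G (linext f v).
Proof.
move=> Gf; rewrite /linext big_seq.
by apply: lspan_sum => b /Gf; apply: lspanZ.
Qed.

(* A [theta]-fixed vector is half the sum of itself and its image, and in that sum
   the monomials of odd length cancel. *)
Lemma M1plus_span (charF : [pchar F] =i pred0) (v : V) : M1plus v ->
  lspan (fun g => exists2 s, ~~ odd (size s) & g = word s) v.
Proof.
move=> [v0 vtheta].
have vE : v = 2^-1 *: linext (fun b => bvec F b + theta_b F b) v.
  have -> : linext (fun b => bvec F b + theta_b F b) v = v + theta v.
    apply: etrans _ (congr1 (fun w => w + theta v) (esym (bvec_sum v))).
    rewrite /theta /linext -big_split.
    by apply: eq_bigr => b _; rewrite scalerDr.
  rewrite vtheta -[v in RHS]scale1r -scalerDl scalerA mulVf ?scale1r //.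
  exact: (natr_neq0 charF 1).
rewrite vE; apply/lspanZ/linext_span => -[A m] /v0 /= ->.
have -> : theta_b F (A, 0) = (-1) ^+ size (enum_mset A) *: bvec F (A, 0).
  exact: erefl.
case: (boolP (odd (size (enum_mset A)))) => oA.
  rewrite -signr_odd oA expr1 scaleN1r subrr; exact: lspan0.
rewrite -signr_odd (negPf oA) expr0 scale1r; apply: lspanD.
  by apply: lspan_gen; exists (enum_mset A); rewrite ?word_enum.
by apply: lspan_gen; exists (enum_mset A); rewrite ?word_enum.
Qed.

Lemma cr2_vac a b : cr a (cr b (vac F)) = word [:: a; b].
Proof. by rewrite vac_word !cr_word. Qed.

Lemma omegaE : omega F k = (4 * k)%:R^-1 *: word [:: 0; 0]%N.
Proof.
have e : heis k (-1) (heis k (-1) (vac F)) = word [:: 0; 0]%N := cr2_vac 0 0.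
by rewrite /omega e.
Qed.

Lemma JvecE : Jvec F k = (4 * k ^ 2)%:R^-1 *: word [:: 0; 0; 0; 0]%N
  - k%:R^-1 *: word [:: 2; 0]%N + (3%:R / (4 * k)%:R) *: word [:: 1; 1]%N.
Proof.
have e4 : cr 0 (cr 0 (cr 0 (cr 0 (vac F)))) = word [:: 0; 0; 0; 0]%N.
  by rewrite vac_word !cr_word.
apply: (congr2 (fun u w => u + _ *: w)); last exact: (cr2_vac 1 1).
by apply: (congr2 (fun u w => _ *: u - _ *: w)); [exact: e4|exact: (cr2_vac 2 0)].
Qed.

Lemma Lop_word s : Lop k (-2) (word s) = (4 * k)%:R^-1 *: Q 0 0 0 (word s).
Proof.
have e : Ymode k (word [:: 0; 0]%N) (-2 + 1) (word s) = Q 0 0 0 (word s).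
  exact: Ymode_quad.
by rewrite /Lop omegaE YmodeZ e.
Qed.

Lemma Ymode_Jvec_vac : Ymode k (Jvec F k) (-1) (vac F) = Jvec F k.
Proof.
pose f : {linear V -> V} :=
  linext (fun b => linext (@modeB F k (enum_mset b.1) b.2 (-1)) (word [::])).
rewrite vac_word; apply: (@lspan_eq F V (fun g => exists s, g = word s) f idfun).
  by move=> _ [s ->]; apply: Ymode_vac.
have G s : lspan (fun g => exists s, g = word s) (word s).
  by apply: lspan_gen; exists s.
rewrite JvecE; apply: lspanD; last by apply: lspanZ.
apply: lspanD; first by apply: lspanZ.
by rewrite -scaleNr; apply: lspanZ.
Qed.

(** The set [G] to which the reduction is applied: the target vectors together with modes lying in
    C_2. *)
Definition spanning (v : V) : Prop :=
  (exists s t, v = LJ F k s t) \/ c2_mode (2 * k)%:R word cr_op der_op v.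

Lemma M1plus_spanning (charF : [pchar F] =i pred0) (k_gt0 : (0 < k)%N) (v : V) :
  M1plus v -> lspan spanning v.
Proof.
have k0 : k%:R != 0 :> F by rewrite ((pcharf0P F).1 charF) -lt0n.
have two0 := natr_neq0 charF 1.
have kap0 : (2 * k)%:R != 0 :> F by rewrite natrM mulf_neq0.
have Lw s : Lop k (-2) (word s) = (2 * (2 * k)%:R)^-1 *: Q 0 0 0 (word s).
  by rewrite -natrM mulnA; apply: Lop_word.
move/(M1plus_span charF); apply: lspan_sub => _ [s es ->].
refine (even_word_in charF (@word_perm) cr_op_word cr_op_comm
  der_vac der_op_cr kap0 (G := spanning) (L := Lop k (-2)) Lw _ _ _ _ es).
(* L(-2) raises the first index of [LJ], and [c2_mode_L] handles the modes. *)
- move=> w; apply: lspan_map => g [[a [b ->]]|cg].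
    by apply: lspan_gen; left; exists a.+1, b.
  apply: lspan_sub (c2_mode_L charF cr_op_word cr_op_comm der_vac der_op_cr kap0 Lw cg).
  by move=> h ch; apply: lspan_gen; right.
- by apply: lspan_gen; left; exists 0%N, 0%N; exact: esym vac_word.
- by move=> a b t et; apply: lspan_gen; right; exists t => //; exists a, b.
(* J equals J_{-1}1; its coefficients are rewritten in terms of the norm 2k. *)
apply: lspan_gen; left; exists 0%N, 1%N.
apply/esym; apply: etrans Ymode_Jvec_vac _; apply: etrans JvecE _.
rewrite !natrM.
have -> : (4 * (k%:R * k%:R))^-1 = (2 * k%:R) ^- 2 :> F by field; rewrite !(natr_neq0 charF) k0.
have -> : k%:R^-1 = 2 / (2 * k%:R) :> F by field; rewrite !(natr_neq0 charF) k0.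
by have -> : 3 / (4 * k%:R) = 3 / (2 * (2 * k%:R)) :> F
  by field; rewrite !(natr_neq0 charF) k0.
Qed.

Lemma M1plus_C2 (charF : [pchar F] =i pred0) (k_gt0 : (0 < k)%N) (v : V) :
  M1plus v -> exists2 u, lspan (fun g => exists s t, g = LJ F k s t) u & C2 k (v - u).
Proof.
move=> /(M1plus_spanning charF k_gt0); apply: lspan_split.
- exact: C2_0.
- exact: C2P.
by move=> g [LJg|/C2_mode_in]; [right|left].
Qed.

End Fock.

(* Theorem 4.9: for k >= 3, (M(1)^+ + C_2(V_L^+)) / C_2(V_L^+) is spanned by the
   classes of L(-2)^s J_{-1}^t 1 (s, t >= 0): every v in M(1)^+ is congruent
   modulo C_2(V_L^+) to a finite linear combination of these vectors. *)
Theorem theorem4p9 (F : fieldType) (charF : [pchar F] =i pred0)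
    (k : nat) (hk : (3 <= k)%N) (v : VL F) (hv : M1plus v) :
  exists (n : nat) (c : 'I_n -> 'I_n -> F),
    C2 k (v - \sum_(s < n) \sum_(t < n) c s t *: LJ F k s t).
Proof.
have k_gt0 : (0 < k)%N by apply: leq_trans hk.
have [u LJu C2u] := M1plus_C2 charF k_gt0 hv.
have [n [c uE]] := lspan_double_sum LJu.
by exists n, (fun s t => c s t); rewrite -uE.
Qed.
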